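(* Suppose that $\mathcal Z$ consists of independent (mean-zero) Gaussian entries with variances lower bounded by $\sigma_{\min}^2$, and suppose that $\kappa^2\mu_0\sqrt{r/p}\ll1$. Let $k\in\{1,2,3\}$ and $1\le m\le p_k$. If $(\widetilde{\mathbf U}_k)_{m\cdot}$ is any unbiased estimator of $(\mathbf U_k)_{m\cdot}$ (based on the observation $\widetilde{\mathcal T}=\mathcal T+\mathcal Z$), then $$\mathrm{Var}\big((\widetilde{\mathbf U}_k)_{m\cdot}\big)\succcurlyeq\sigma_{\min}^2(1-o(1))\,\mathbf\Lambda_k^{-2},$$ where $A\succcurlyeq B$ refers to the positive semidefinite ordering.
   Context: Notation. $a\lesssim b$ means $a\le Cb$ for a universal constant $C>0$; $a\asymp b$ means $a\lesssim b\lesssim a$; $a\ll b$ (also $a=o(b)$) means $a/b\to0$. Asymptotics are as $p\to\infty$. $\|\mathbf M\|$ is the spectral norm, $\|\mathbf M\|_{2,\infty}=\max_i\|\mathbf M_{i\cdot}\|$; rows are viewed as column vectors. $\mathrm{SVD}_r(\mathbf M)$ is the matrix of leading $r$ left singular vectors. Mode indices are understood modulo 3. The mode-$k$ matricization $\mathcal M_k(\mathcal T)$ of $\mathcal T\in\mathbb R^{p_1\times p_2\times p_3}$ has $\mathcal T_{i_1i_2i_3}$ in row $i_k$ and column $(i_{k+1}-1)p_{k+2}+i_{k+2}$; $\times_k$ is the mode-$k$ product. Model. One observes $\widetilde{\mathcal T}=\mathcal T+\mathcal Z\in\mathbb R^{p_1\times p_2\times p_3}$, with $\mathcal Z$ having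 independent mean-zero entries of variance $\sigma_{ijk}^2$, $\sigma_{\min}\le\sigma_{ijk}\le\sigma\le C\sigma_{\min}$. Also $p_k\asymp p$, $r_k\asymp r$ for all $k$. The signal has Tucker rank $(r_1,r_2,r_3)$: $\mathcal T=\mathcal C\times_1\mathbf U_1\times_2\mathbf U_2\times_3\mathbf U_3$ with $\mathcal C\in\mathbb R^{r_1\times r_2\times r_3}$, $\mathbf U_k=\mathrm{SVD}_{r_k}(\mathcal M_k(\mathcal T))$, and rank-$r_k$ SVD $\mathcal M_k(\mathcal T)=\mathbf U_k\mathbf\Lambda_k\mathbf V_k^\top$. $\kappa=\max_k\|\mathcal M_k(\mathcal T)\|/\lambda_{r_k}(\mathcal M_k(\mathcal T))$ with $\lambda_{r_k}$ the $r_k$-th singular value; $\mu_0$ is the smallest number with $\max_k\sqrt{p_k/r_k}\,\|\mathbf U_k\|_{2,\infty}\le\mu_0$. *)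

(* Defs.v *)
From HB Require Import structures.
From mathcomp Require Import all_boot all_order all_algebra.
From mathcomp Require Import all_classical all_reals all_analysis.

Set Implicit Arguments.
Unset Strict Implicit.
Unset Printing Implicit Defensive.

Import Order.TTheory GRing.Theory Num.Theory.
Import numFieldNormedType.Exports.
Local Open Scope classical_set_scope.
Local Open Scope ring_scope.

Definition lesssim (R : realType) (a b : nat -> R) : Prop :=
  exists2 C : R, 0 < C & forall n, a n <= C * b n.

Definition asymp (R : realType) (a b : nat -> R) : Prop :=
  lesssim a b /\ lesssim b a.

(* Modes are the elements of 'I_3 and [ordS] is the cyclic successor; a tensor *)
(* with dimensions (p 0, p 1, p 2) is a function of its multi-index.           *)
Definition midx (p : 'I_3 -> nat) := {dffun forall j : 'I_3, 'I_(p j)}.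

Definition tensor (R : realType) (p : 'I_3 -> nat) := midx p -> R.

(* Mode-k matricization: each sum has exactly one term, the entry whose mode-k *)
(* index is a and whose other two indices (0-based) encode the column c.       *)
Definition unfold (R : realType) (p : 'I_3 -> nat) (k : 'I_3) (T : tensor R p) :
    'M[R]_(p k, p (ordS k) * p (ordS (ordS k))) :=
  \matrix_(a, c) \sum_(i : midx p |
    (i k == a) && (c == i (ordS k) * p (ordS (ordS k)) + i (ordS (ordS k)) :> nat)%N)
    T i.

Record tucker_param (R : realType) (p r : 'I_3 -> nat) := TuckerParam {
  core : tensor R r;
  fac : forall j : 'I_3, 'M[R]_(p j, r j)
}.

(* core x_1 U_1 x_2 U_2 x_3 U_3, entrywise. *)
Definition signal (R : realType) (p r : 'I_3 -> nat) (th : tucker_param R p r) :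
    tensor R p :=
  fun i => \sum_(a : midx r) core th a * \prod_(j < 3) fac th j (i j) (a j).

Definition set_fac (R : realType) (p r : 'I_3 -> nat) (th : tucker_param R p r)
    (k : 'I_3) (W : 'M[R]_(p k, r k)) : tucker_param R p r :=
  TuckerParam (core th) (dfwith (fac th) k W).

Definition orthonormal_cols (R : realType) (m n : nat) (W : 'M[R]_(m, n)) : Prop :=
  W^T *m W = 1%:M.

(* (U, lam, V) is a rank-s singular value decomposition of M, with the s       *)
(* (positive) singular values in nonincreasing order.                          *)
Definition is_rank_svd (R : realType) (m n s : nat) (M : 'M[R]_(m, n))
    (U : 'M[R]_(m, s)) (lam : 'rV[R]_s) (V : 'M[R]_(n, s)) : Prop :=
  [/\ orthonormal_cols U, orthonormal_cols V,
      forall a, 0 < lam 0 a,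
      forall a b : 'I_s, (a <= b)%N -> lam 0 b <= lam 0 a &
      M = U *m diag_mx lam *m V^T].

(* The signal has Tucker rank r and, for every mode j, fac th j consists of    *)
(* leading r j left singular vectors of the mode-j matricization.              *)
Definition tucker_model (R : realType) (p r : 'I_3 -> nat)
    (th : tucker_param R p r) : Prop :=
  forall j : 'I_3, exists lam V,
    is_rank_svd (unfold j (signal th)) (fac th j) lam V.

Definition norm2 (R : realType) (n : nat) (x : 'cV[R]_n) : R :=
  Num.sqrt (\sum_i x i 0 ^+ 2).

Definition spectral_norm (R : realType) (m n : nat) (M : 'M[R]_(m, n)) : R :=
  sup [set norm2 (M *m x) | x in [set x | norm2 x <= 1]].

Definition norm2inf (R : realType) (m n : nat) (M : 'M[R]_(m, n)) : R :=
  \big[Num.max/0]_(i < m) norm2 (row i M)^T.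

(* [lam j] lists the r j singular values of the mode-j matricization of T in   *)
(* nonincreasing order, so its entry of index (r j).-1 is the r_j-th one.      *)
Definition kappa (R : realType) (p r : 'I_3 -> nat) (T : tensor R p)
    (lam : forall j : 'I_3, 'rV[R]_(r j)) : R :=
  \big[Num.max/0]_(j < 3)
    (spectral_norm (unfold j T) / [seq lam j 0 a | a <- enum 'I_(r j)]`_(r j).-1).

(* The smallest mu with max_j sqrt (p j / r j) * norm2inf (U j) <= mu. *)
Definition mu0 (R : realType) (p r : 'I_3 -> nat)
    (U : forall j : 'I_3, 'M[R]_(p j, r j)) : R :=
  \big[Num.max/0]_(j < 3) (Num.sqrt ((p j)%:R / (r j)%:R) * norm2inf (U j)).

Definition mutually_independent (R : realType) (d : measure_display)
    (Omega : measurableType d) (P : probability Omega R) (I : finType)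
    (Z : I -> Omega -> R) : Prop :=
  forall (J : {set I}) (B : I -> set R), (forall i, measurable (B i)) ->
    P (\bigcap_(i in [set` J]) (Z i @^-1` B i)) =
    (\prod_(i in J) P (Z i @^-1` B i))%E.

(* The entries of Z are independent, Z i ~ N(0, (sigma i)^2); the second       *)
(* argument of [normal_prob] is the standard deviation.                        *)
Definition gaussian_noise (R : realType) (d : measure_display)
    (Omega : measurableType d) (P : probability Omega R) (p : 'I_3 -> nat)
    (Z : midx p -> {RV P >-> R}) (sigma : tensor R p) : Prop :=
  mutually_independent P (fun i => Z i : Omega -> R) /\
  forall i (B : set R), measurable B ->
    distribution P (Z i) B = normal_prob 0 (sigma i) B.

Definition observe (R : realType) (d : measure_display)
    (Omega : measurableType d) (P : probability Omega R) (p : 'I_3 -> nat)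
    (T : tensor R p) (Z : midx p -> {RV P >-> R}) (w : Omega) : tensor R p :=
  fun i => T i + Z i w.

Definition cylinders (R : realType) (p : 'I_3 -> nat) : set (set (tensor R p)) :=
  [set A | exists (i : midx p) (B : set R),
    measurable B /\ A = [set t : tensor R p | B (t i)]].

(* An estimator is a Borel function of the observed tensor. *)
Definition measurable_estimator (R : realType) (p : 'I_3 -> nat) (s : nat)
    (X : tensor R p -> 'cV[R]_s) : Prop :=
  forall a : 'I_s,
    measurable_fun [set: g_sigma_algebraType (@cylinders R p)]
      (fun t : g_sigma_algebraType (@cylinders R p) => X t a 0).

(* The k-th factor is a function of the signal tensor only up to the signs (or *)
(* rotations) of the singular vectors, so a parameter space is taken to be a   *)
(* set Theta of Tucker parameters, typically one representative per tensor     *)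
(* according to some SVD convention.  For example, fixing the right singular   *)
(* vectors as a function of the Gram matrix M_k(T)^T M_k(T) gives a Theta that *)
(* represents every tensor of the given Tucker rank and is stable under all    *)
(* changes of U_k.  All that is asked of Theta is that its elements satisfy    *)
(* the model and that U_k can vary freely near its true value.                 *)
Definition parameter_space (R : realType) (p r : 'I_3 -> nat)
    (Theta : set (tucker_param R p r)) (th : tucker_param R p r)
    (k : 'I_3) : Prop :=
  Theta `<=` (@tucker_model R p r) /\
  \forall W \near fac th k, orthonormal_cols W -> Theta (@set_fac R p r th k W).

(* E X(T' + Z) = (U'_k)_m for all parameters in Theta, T' being the signal. *)
Definition unbiased (R : realType) (d : measure_display)
    (Omega : measurableType d) (P : probability Omega R) (p r : 'I_3 -> nat)
    (Z : midx p -> {RV P >-> R}) (Theta : set (tucker_param R p r))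
    (k : 'I_3) (m : 'I_(p k)) (X : tensor R p -> 'cV[R]_(r k)) : Prop :=
  forall th, Theta th -> forall a : 'I_(r k),
    let Xa := fun w => X (observe (signal th) Z w) a 0 in
    Xa \in Lfun P 1 /\ ('E_P[Xa] = (fac th k m a)%:E)%E.

Definition covariance_mx (R : realType) (d : measure_display)
    (Omega : measurableType d) (P : probability Omega R) (s : nat)
    (Y : Omega -> 'cV[R]_s) : 'M[R]_s :=
  \matrix_(a, b) fine (covariance P (fun w => Y w a 0) (fun w => Y w b 0)).

Definition psd (R : realType) (s : nat) (A : 'M[R]_s) : Prop :=
  A^T = A /\ forall v : 'cV[R]_s, 0 <= (v^T *m A *m v) 0 0.

(* Positive semidefinite ordering: A is above B. *)
Definition psd_ge (R : realType) (s : nat) (A B : 'M[R]_s) : Prop := psd (A - B).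

(* Main.v *)
Require Import Defs.
From HB Require Import structures.
From mathcomp Require Import all_boot all_order all_algebra.
From mathcomp Require Import all_classical all_reals all_analysis.
From mathcomp Require Import measurable_realfun ring lra.

Set Implicit Arguments.
Unset Strict Implicit.
Unset Printing Implicit Defensive.

Import Order.TTheory GRing.Theory Num.Theory.
Import numFieldNormedType.Exports.
Local Open Scope classical_set_scope.
Local Open Scope ring_scope.

(** The variance bound is a Cramer-Rao bound along a single well-chosen curve
    of factors, obtained without differentiating under the expectation.

    Fix the dimensions, the mode [k], the row [m], and write [U] for the [k]-th
    factor, so that the mode-[k] matricization of the signal is [U D V^T] with
    [D] the diagonal matrix of singular values.  Replacing [U] by another
    orthonormal [W] close to [U] turns the signal into the tensor with
    matricization [W D V^T] ([signal_set_facE]), and unbiasedness forces the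
    mean of the estimator to move from row [m] of [U] to row [m] of [W].
    Translating a Gaussian noise multiplies its law by an explicit likelihood
    ratio [L] ([ge0_integral_noise_translate]) with [E L = 1] and
    [E L^2 = exp (sum_i h_i^2 / sigma_i^2)], [h] being the change of signal.
    The Cauchy-Schwarz inequality applied to the covariance of the estimator
    with [L] is the Hammersley-Chapman-Robbins inequality
      (change of mean)^2 <= variance * (exp (sum_i h_i^2 / sigma_i^2) - 1)
    ([hammersley_chapman_robbins]).

    For a direction [v], let [w = D^-2 v], let [q = v^T D^-2 v], and let
    [g = (1 - U U^T) e_m] be the part of the [m]-th basis vector orthogonal to
    the columns of [U]; then [g_m = |g|^2 = G] with [G = 1 - |U_m|^2].  The
    curve [stiefel_curve] stays orthonormal and leaves [U] in the direction
    [g w^T]: at first order in its speed [b] the mean of [v^T X] moves by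
    [b G q] and the signal moves by a tensor of squared norm [b^2 G q].
    Letting [b] tend to 0 gives [variance >= smin^2 G q]
    ([chapman_robbins_limit], [variance_row_ge]).  The choice [w = D^-2 v] is
    what makes a one-dimensional family suffice for the matrix bound.

    The loss is the factor [G], which tends to 1 uniformly: [|U_m|^2] is at most
    [mu0^2 r_k / p_k], and since the condition number [kappa] is at least 1 this
    is, up to a constant, dominated by the square of the incoherence parameter
    ([norm2inf_le_incoherence]). *)

(** * Measures given by a density *)

Section density.
Local Open Scope ereal_scope.
Context d (T : measurableType d) (R : realType) (mu : {measure set T -> \bar R}).

(** The measurability and sign proofs are arguments so that the measure
    structure below can be inferred from the term itself. *)
Definition density (g : T -> R) (mg : measurable_fun [set: T] g)
  (g0 : forall x, (0 <= g x)%R) : set T -> \bar R :=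
  fun A => \int[mu]_(x in A) (g x)%:E.

Variables (g : T -> R) (mg : measurable_fun [set: T] g).
Hypothesis g0 : forall x, (0 <= g x)%R.

Let density_set0 : density mg g0 set0 = 0.
Proof. by rewrite /density integral_set0. Qed.

Let density_ge0 A : 0 <= density mg g0 A.
Proof. by apply: integral_ge0 => x _; rewrite lee_fin. Qed.

Let density_sigma_additive : semi_sigma_additive (density mg g0).
Proof.
move=> A mA tA mUA; rewrite /density ge0_integral_bigcup//.
- by apply: is_cvg_ereal_nneg_natsum_cond => n _ _; exact: density_ge0.
- exact/measurable_EFinP/measurable_funTS.
- by move=> x _; rewrite lee_fin.
Qed.

HB.instance Definition _ := isMeasure.Build _ _ _ (density mg g0)
  density_set0 density_ge0 density_sigma_additive.

Import HBNNSimple.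

(** By definition for indicators, by linearity for simple functions, and by
    monotone convergence in general. *)
Lemma ge0_integral_density (f : T -> \bar R) :
  measurable_fun [set: T] f -> (forall x, 0 <= f x) ->
  \int[density mg g0]_x f x = \int[mu]_x (f x * (g x)%:E).
Proof.
move=> mf f0; pose f_ := nnsfun_approx measurableT mf.
have cvgf x : EFin \o f_^~ x @ \oo --> f x by apply: cvg_nnsfun_approx.
have indE A : measurable A ->
    \int[density mg g0]_x (\1_A x)%:E = \int[mu]_x ((\1_A x)%:E * (g x)%:E).
  move=> mA; rewrite integral_indic// setIT /= /density integral_mkcond.
  by apply: eq_integral => x _; rewrite epatch_indic/= muleC.
have simE (h : {nnsfun T >-> R}) :
    \int[density mg g0]_x (h x)%:E = \int[mu]_x ((h x)%:E * (g x)%:E).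
  under [LHS]eq_integral do rewrite fimfunE -fsumEFin//.
  rewrite [LHS]ge0_integral_fsum//; last 2 first.
    by move=> r; exact/measurable_EFinP/measurableT_comp.
    by move=> n x _; rewrite EFinM nnfun_muleindic_ge0.
  under [RHS]eq_integral => x _.
    rewrite fimfunE -fsumEFin// ge0_mule_fsuml; last first.
      by move=> r; rewrite EFinM nnfun_muleindic_ge0.
    over.
  rewrite [RHS]ge0_integral_fsum//; last 2 first.
    move=> r; apply/measurable_EFinP; apply: measurable_funM => //.
    by apply: measurable_funM => //; exact: measurable_indic.
    by move=> n x _; rewrite mule_ge0 ?lee_fin// -lee_fin EFinM nnfun_muleindic_ge0.
  apply: eq_fsbigr => r /[!inE] -[t _ <-].
  under eq_integral do rewrite EFinM.
  under [RHS]eq_integral do rewrite EFinM -muleA.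
  rewrite ge0_integralZl ?lee_fin//; last by apply/measurable_EFinP; exact: measurable_indic.
  rewrite indE// ge0_integralZl ?lee_fin//.
    by apply/measurable_EFinP; apply: measurable_funM => //; exact: measurable_indic.
  by move=> x _; rewrite mule_ge0 ?lee_fin.
transitivity (limn (fun n => \int[density mg g0]_x (f_ n x)%:E)).
  rewrite -monotone_convergence//.
  - by apply: eq_integral => x _; apply/esym/cvg_lim => //; exact: cvgf.
  - by move=> n; exact/measurable_EFinP/measurable_funP.
  - by move=> n x _; rewrite lee_fin.
  - by move=> x _ m n mn; rewrite lee_fin; exact/lefP/nd_nnsfun_approx.
under eq_fun do rewrite simE.
rewrite -monotone_convergence//.
- apply: eq_integral => x _; apply/cvg_lim => //.
  by apply: cvgeZr => //; exact: cvgf.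
- by move=> n; apply/measurable_EFinP; apply: measurable_funM.
- by move=> n x _; rewrite mule_ge0// lee_fin.
- move=> x _ m n mn; rewrite lee_wpmul2r// lee_fin//.
  exact/lefP/nd_nnsfun_approx.
Qed.

End density.

(** * Translation of a one-dimensional Gaussian law *)

Section one_dimensional_shift.
Local Open Scope ereal_scope.
Context (R : realType).
Local Notation mu := (@lebesgue_measure R).

(** The image of Lebesgue measure under a translation gives every half-open
    interval its length, so it is Lebesgue measure. *)
Lemma ge0_integral_lebesgue_shift (h : R) (B : set R) (f : R -> \bar R) :
  measurable B -> measurable_fun [set: R] f -> (forall x, 0 <= f x) ->
  \int[mu]_(x in [set x | B (x + h)%R]) f (x + h)%R = \int[mu]_(x in B) f x.
Proof.
move=> mB mf f0.
have mshift : measurable_fun [set: measurableTypeR R]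
    (fun x : measurableTypeR R => (x + h)%R : measurableTypeR R).
  exact: measurable_funD.
rewrite -[LHS](@ge0_integral_pushforward _ _ _ _ _ _ mshift mu B f)//; last first.
  exact: measurable_funTS.
apply: eq_measure_integral => A mA _.
rewrite [RHS](@lebesgue_measure_unique R (pushforward mu
  (fun x : measurableTypeR R => (x + h)%R : measurableTypeR R))) //.
move=> X; rewrite ocitvP => -[->|[[a b] /= ab ->]]; first by rewrite !measure0.
rewrite /= /pushforward.
have -> : (fun x => x + h)%R @^-1` `]a, b] = `](a - h)%R, (b - h)%R]%classic.
  by apply/seteqP; split => x /=; rewrite !in_itv/= ltrBlDr lerBrDr.
rewrite !lebesgue_measure_itv/= !lte_fin ltrD2r ab -!EFinB; congr (_%:E); ring.
Qed.

(** The density of N(h, s^2) with respect to N(0, s^2). *)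
Definition gauss_tilt (s h x : R) : R :=
  expR (h * x / s ^+ 2 - h ^+ 2 / (s ^+ 2 *+ 2)).

Lemma measurable_gauss_tilt (s h : R) : measurable_fun [set: R] (gauss_tilt s h).
Proof.
apply: measurableT_comp => //; apply: measurable_funB => //.
by apply: measurable_funM => //; exact: measurable_funM.
Qed.

Lemma gauss_tilt_ge0 (s h x : R) : (0 <= gauss_tilt s h x)%R.
Proof. exact: expR_ge0. Qed.

Lemma gauss_tilt_pdf (s h x : R) : s != 0%R ->
  (gauss_tilt s h x * normal_pdf 0 s x)%R = normal_pdf 0 s (x - h)%R.
Proof.
move=> s0; rewrite normal_pdfE//= /gauss_tilt /normal_fun mulrCA -expRD.
congr (_ * expR _)%R; by field.
Qed.

Lemma normal_prob_fin_num (s : R) (B : set R) :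
  measurable B -> normal_prob 0 s B \is a fin_num.
Proof.
by move=> mB; exact: (fin_num_measure (normal_prob 0 s : probability _ R)).
Qed.

Lemma integral_gauss_tilt (s h : R) (B : set R) : s != 0%R -> measurable B ->
  \int[normal_prob 0 s]_(x in B) (gauss_tilt s h x)%:E =
  normal_prob 0 s [set x | B (x + h)%R].
Proof.
move=> s0 mB; rewrite integral_mkcond.
have mpdf := @measurable_normal_pdf R 0 s.
have pdf0 := @normal_pdf_ge0 R 0 s.
rewrite (@eq_measure_integral _ _ _ _ (density mu mpdf pdf0))//.
rewrite ge0_integral_density//; last 2 first.
- apply/(measurable_restrictT _ _).1 => //.
  apply/measurable_EFinP/measurable_funTS; exact: measurable_gauss_tilt.
- by move=> x; rewrite patchE; case: ifP => // _; rewrite lee_fin gauss_tilt_ge0.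
rewrite /normal_prob.
transitivity (\int[mu]_(x in B) (normal_pdf 0 s (x - h)%R)%:E).
  rewrite [RHS]integral_mkcond; apply: eq_integral => x _.
  by rewrite !patchE; case: ifP => _; rewrite ?mul0e// -EFinM gauss_tilt_pdf.
rewrite -(@ge0_integral_lebesgue_shift h B (fun x => (normal_pdf 0 s (x - h))%:E))//.
- by apply: eq_integral => x _; rewrite addrK.
- apply/measurable_EFinP; apply: measurableT_comp => //; exact: measurable_funB.
- by move=> x; rewrite lee_fin.
Qed.

End one_dimensional_shift.

(** * Measurability on tensors *)

Section tensor_measurability.
Context (R : realType) (p : 'I_3 -> nat).
Local Notation tensorT := (g_sigma_algebraType (@cylinders R p)).

Lemma measurable_coord (i : midx p) :
  measurable_fun [set: tensorT] (fun t : tensorT => t i).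
Proof.
by move=> _ B mB; rewrite setTI; apply: sub_sigma_algebra; exists i, B.
Qed.

(** The tensor sigma-algebra is generated by the coordinates. *)
Lemma measurable_to_tensor d (S : measurableType d) (f : S -> tensorT) :
  (forall i, measurable_fun [set: S] (fun x => f x i)) ->
  measurable_fun [set: S] f.
Proof.
move=> mf; apply: (@measurability _ _ S tensorT setT f (@cylinders R p)) => //.
by move=> _ [_ [i [B [mB ->]]] <-]; exact: (mf i).
Qed.

Definition box (B : midx p -> set R) : set tensorT :=
  [set t | forall i, B i (t i)].

Lemma box_bigcap (B : midx p -> set R) :
  box B = \bigcap_(i in [set: midx p]) ((fun t : tensorT => t i) @^-1` B i).
Proof. by apply/seteqP; split => [t Bt i _|t Bt i]; exact: Bt. Qed.

Lemma measurable_box (B : midx p -> set R) :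
  (forall i, measurable (B i)) -> measurable (box B).
Proof.
move=> mB; rewrite box_bigcap; apply: fin_bigcap_measurable => [|i _]; first exact: finite_finset.
by rewrite -[X in measurable X]setTI; exact: measurable_coord.
Qed.

Definition boxes : set (set tensorT) :=
  [set A | exists2 B, forall i, measurable (B i) & A = box B].

(** Boxes are stable under intersection and generate the tensor sigma-algebra. *)
Lemma measure_eq_boxes (m1 m2 : {measure set tensorT -> \bar R}) :
  (m1 [set: tensorT] < +oo)%E ->
  (forall B, (forall i, measurable (B i)) -> m1 (box B) = m2 (box B)) ->
  forall A, measurable A -> m1 A = m2 A.
Proof.
move=> m1fin m12; have boxT : boxes [set: tensorT].
  by exists (fun=> setT) => //; apply/seteqP; split.
apply: (@measure_unique _ _ _ boxes (fun=> [set: tensorT])) => //.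
- apply/seteqP; split; last first.
    apply: smallest_sub; first exact: sigma_algebra_measurable.
    by move=> _ [B mB ->]; exact: measurable_box.
  apply: sub_smallest2r; first exact: smallest_sigma_algebra.
  move=> _ [i [B [mB ->]]].
  exists (fun j => if j == i then B else setT).
    by move=> j; case: ifP.
  apply/seteqP; split => [t Bt j|t /(_ i)]; last by rewrite eqxx.
  by case: eqP => // ->.
- move=> _ _ [B mB ->] [C mC ->]; exists (fun i => B i `&` C i).
    by move=> i; exact: measurableI.
  by apply/seteqP; split=> [t [Bt Ct] i|t BCt]; [split|split=> i; case: (BCt i)].
- by apply/seteqP; split => // t _; exists 0%N.
- by move=> _ [B mB ->]; exact: m12.
Qed.

End tensor_measurability.

(** * Translation of one coordinate of a Gaussian tensor *)

Section gaussian_shift.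
Local Open Scope ereal_scope.
Context (R : realType) (p : 'I_3 -> nat).
Local Notation tensorT := (g_sigma_algebraType (@cylinders R p)).
Variables (Q : {measure set tensorT -> \bar R}) (sigma : tensor R p).
Hypothesis sigma_neq0 : forall i, sigma i != 0%R.
Hypothesis Q_box : forall B, (forall i, measurable (B i)) ->
  Q (box B) = \prod_i normal_prob 0 (sigma i) (B i).

Definition shift_coord (i : midx p) (a : R) (t : tensorT) : tensorT :=
  fun j => (t j + if j == i then a else 0)%R.

Lemma measurable_shift_coord i a : measurable_fun [set: tensorT] (shift_coord i a).
Proof.
apply: measurable_to_tensor => j; apply: measurable_funD => //.
exact: measurable_coord.
Qed.

Definition set_side (B : midx p -> set R) (i : midx p) (C : set R) j :=
  if j == i then C else B j.

Lemma measurable_set_side B i C : (forall i, measurable (B i)) ->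
  measurable C -> forall j, measurable (set_side B i C j).
Proof. by move=> mB mC j; rewrite /set_side; case: ifP. Qed.

(** Varying one side of a box, the law [Q] is a multiple of the marginal law of
    that coordinate; this is all the independence that is used. *)
Lemma Q_set_side B i C : (forall i, measurable (B i)) -> measurable C ->
  Q (box (set_side B i C)) =
  (\prod_(j | j != i) fine (normal_prob 0 (sigma j) (B j)))%:E
    * normal_prob 0 (sigma i) C.
Proof.
move=> mB mC; rewrite Q_box; last exact: measurable_set_side.
rewrite (bigD1 i)//= {1}/set_side eqxx muleC; congr (_ * _).
rewrite -prodEFin; apply: eq_bigr => j ji.
by rewrite /set_side (negbTE ji) fineK//; exact: normal_prob_fin_num.
Qed.

Lemma Q_setT : Q [set: tensorT] = 1.
Proof.
rewrite (_ : setT = box (fun=> setT)); last by apply/seteqP; split.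
by rewrite Q_box// big1// => i _; exact: probability_setT.
Qed.

(** Restrict [Q] to the constraints on the other coordinates and push it to the
    [i]-th one: by [Q_set_side] this is a multiple of the Gaussian marginal, to
    which [integral_gauss_tilt] applies. *)
Lemma integral_box_tilt B i a : (forall i, measurable (B i)) ->
  \int[Q]_(t in box B) (gauss_tilt (sigma i) a (t i))%:E =
  Q (box (set_side B i [set x | B i (x + a)%R])).
Proof.
move=> mB; have mcoord := @measurable_coord R p i.
set E := box (set_side B i setT).
have mE : measurable E by apply: measurable_box; exact: measurable_set_side.
(* The constraint on coordinate [i] is moved into the integrand, so that the
   remaining box [E] constrains the other coordinates only. *)
pose phi := (fun x => (gauss_tilt (sigma i) a x)%:E) \_ (B i).
have phi0 x : 0 <= phi x.
  by rewrite /phi patchE; case: ifP => // _; rewrite lee_fin gauss_tilt_ge0.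
have mphi : measurable_fun [set: R] phi.
  apply/(measurable_restrictT _ _).1 => //.
  by apply/measurable_EFinP/measurable_funTS; exact: measurable_gauss_tilt.
pose cE := (\prod_(j | j != i) fine (normal_prob 0 (sigma j) (B j)))%R.
have cE0 : (0 <= cE)%R by apply: prodr_ge0 => j _; rewrite fine_ge0.
have m1E : measurable_fun [set: tensorT] (\1_E : tensorT -> R) by [].
have ind0 t : (0 <= \1_E t :> R)%R by [].
rewrite Q_set_side//; last first.
  rewrite -[X in measurable X]setTI.
  by apply: (measurable_funD (@measurable_id _ R setT) (@measurable_cst _ _ _ _ _ a)).
rewrite -integral_gauss_tilt// [X in _ * X]integral_mkcond -/phi.
transitivity (\int[Q]_t (phi (t i) * (\1_E t)%:E)).
  rewrite integral_mkcond; apply: eq_integral => t _.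
  rewrite /phi !patchE indicE.
  have -> : (t \in box B) = (t i \in B i) && (t \in E).
    apply/idP/andP => [/set_mem Bt|[/set_mem Bti /set_mem Et]].
      split; apply/mem_set; first exact: Bt.
      by move=> j; rewrite /set_side; case: ifP.
    apply/mem_set => j; have := Et j; rewrite /set_side.
    by case: eqP => // ->.
  case: (t i \in B i); last by rewrite mul0e.
  by case: (t \in E); rewrite ?mule1 ?mule0.
rewrite -(ge0_integral_density Q m1E ind0)//; last first.
  exact: (measurableT_comp mphi).
rewrite -[LHS](@ge0_integral_pushforward _ _ _ (measurableTypeR R) _ _ mcoord _ setT phi)//.
rewrite -(@ge0_integral_mscale _ _ _ (normal_prob 0 (sigma i)) setT measurableT
  (NngNum cE0) phi)//.
apply: eq_measure_integral => C mC _; rewrite /= /mscale/= -Q_set_side//.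
rewrite /pushforward /density.
have mCi : measurable ((fun t : tensorT => t i) @^-1` C).
  by rewrite -[X in measurable X]setTI; exact: mcoord.
rewrite integral_indic//; congr (Q _).
apply/seteqP; split => [t [Et Ct] j|t Bt].
  by have := Et j; rewrite /set_side; case: eqP => // ->.
split; first by move=> j; have := Bt j; rewrite /set_side; case: eqP.
by have := Bt i; rewrite /set_side eqxx.
Qed.

(** The image of [Q] under the shift and the tilt of [Q] agree on boxes. *)
Lemma ge0_integral_shift_coord i a (F : tensorT -> \bar R) :
  measurable_fun [set: tensorT] F -> (forall t, 0 <= F t) ->
  \int[Q]_t F (shift_coord i a t) =
  \int[Q]_t (F t * (gauss_tilt (sigma i) a (t i))%:E).
Proof.
move=> mF F0; have mshift := measurable_shift_coord i a.
have mtilt : measurable_fun [set: tensorT]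
    (fun t : tensorT => gauss_tilt (sigma i) a (t i)).
  by apply: measurableT_comp; [exact: measurable_gauss_tilt|exact: measurable_coord].
have tilt0 (t : tensorT) : (0 <= gauss_tilt (sigma i) a (t i))%R.
  exact: gauss_tilt_ge0.
rewrite -(ge0_integral_density Q mtilt tilt0)//.
rewrite -[LHS](@ge0_integral_pushforward _ _ _ _ _ _ mshift Q setT F)//.
apply: eq_measure_integral => A mA _.
apply: measure_eq_boxes => //= [|B mB]; first by rewrite /pushforward/= Q_setT ltry.
rewrite /pushforward /density integral_box_tilt//; congr (Q _).
apply/seteqP; split => t Bt j; have := Bt j; rewrite /set_side /shift_coord.
  by case: eqP => [->|_] //; rewrite addr0.
by case: eqP => [->|_] //; rewrite addr0.
Qed.

End gaussian_shift.

(** * Translation of a Gaussian tensor *)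

Section gaussian_translation.
Local Open Scope ereal_scope.
Context (R : realType) (p : 'I_3 -> nat).
Local Notation tensorT := (g_sigma_algebraType (@cylinders R p)).

(** The density of the law of the translated noise with respect to that of the
    noise, a product by independence. *)
Definition likelihood (sigma h t : tensor R p) : R :=
  (\prod_i gauss_tilt (sigma i) (h i) (t i))%R.

Lemma likelihood_ge0 sigma h t : (0 <= likelihood sigma h t)%R.
Proof. by apply: prodr_ge0 => i _; exact: gauss_tilt_ge0. Qed.

Lemma measurable_prod_tilt (s : seq (midx p)) (sigma h : tensor R p) :
  measurable_fun [set: tensorT]
    (fun t : tensorT => \prod_(i <- s) gauss_tilt (sigma i) (h i) (t i))%R.
Proof.
apply: measurable_prod => i _.
by apply: measurableT_comp; [exact: measurable_gauss_tilt|exact: measurable_coord].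
Qed.

Lemma measurable_likelihood sigma h :
  measurable_fun [set: tensorT] (likelihood sigma h : tensorT -> R).
Proof. exact: measurable_prod_tilt. Qed.

(** The coordinates are translated one after the other: the likelihood factors
    already collected do not depend on the next coordinate. *)
Lemma ge0_integral_translate (Q : {measure set tensorT -> \bar R}) sigma :
  (forall i, sigma i != 0%R) ->
  (forall B, (forall i, measurable (B i)) ->
     Q (box B) = \prod_i normal_prob 0 (sigma i) (B i)) ->
  forall (h : tensor R p) (F : tensorT -> \bar R),
  measurable_fun [set: tensorT] F -> (forall t, 0 <= F t) ->
  \int[Q]_t F (fun i => t i + h i)%R =
  \int[Q]_t (F t * (likelihood sigma h t)%:E).
Proof.
move=> sigma0 Q_box h.
suff translate_seq (s : seq (midx p)) : uniq s -> forall F : tensorT -> \bar R,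
    measurable_fun [set: tensorT] F -> (forall t, 0 <= F t) ->
    \int[Q]_t F (fun i => t i + if i \in s then h i else 0)%R =
    \int[Q]_t (F t * (\prod_(i <- s) gauss_tilt (sigma i) (h i) (t i))%:E).
  move=> F mF F0; rewrite -translate_seq ?index_enum_uniq//.
  apply: eq_integral => t _; congr F; apply/funext => i.
  by rewrite mem_index_enum.
elim: s => [_|i s IHs /= /andP[is_ us]] F mF F0.
  apply: eq_integral => t _; rewrite big_nil mule1; congr F.
  by apply/funext => i; rewrite addr0.
have prod0 (t : tensorT) :
    (0 <= \prod_(j <- s) gauss_tilt (sigma j) (h j) (t j))%R.
  by apply: prodr_ge0 => j _; exact: gauss_tilt_ge0.
pose G (t : tensorT) := F t *
  (\prod_(j <- s) gauss_tilt (sigma j) (h j) (t j))%R%:E.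
transitivity (\int[Q]_t G (shift_coord i (h i) t)).
  rewrite (_ : \int[Q]_t G _ = \int[Q]_t (F (shift_coord i (h i) t) *
      (\prod_(j <- s) gauss_tilt (sigma j) (h j) (t j))%R%:E)); last first.
    apply: eq_integral => t _; congr (_ * _%:E); apply: eq_big_seq => j js.
    rewrite /shift_coord (_ : (j == i) = false) ?addr0//.
    by apply/negbTE; apply: contraNneq is_ => <-.
  rewrite -(IHs us (fun t => F (shift_coord i (h i) t)))//; last first.
    exact: (measurableT_comp mF (@measurable_shift_coord _ _ _ _)).
  apply: eq_integral => t _; congr F; apply/funext => j.
  rewrite /shift_coord inE -addrA; congr (_ + _)%R.
  by case: eqP => [->|_] /=; rewrite ?(negbTE is_) ?add0r ?addr0.
rewrite (ge0_integral_shift_coord sigma0 Q_box).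
- apply: eq_integral => t _.
  by rewrite big_cons mulrC EFinM muleA.
- apply: emeasurable_funM => //.
  by apply/measurable_EFinP; exact: measurable_prod_tilt.
- by move=> t; rewrite mule_ge0// lee_fin.
Qed.

End gaussian_translation.

Section gaussian_noise_translation.
Local Open Scope ereal_scope.
Context (R : realType) (p : 'I_3 -> nat) (d : measure_display)
  (Omega : measurableType d) (P : probability Omega R).
Local Notation tensorT := (g_sigma_algebraType (@cylinders R p)).
Variables (Z : midx p -> {RV P >-> R}) (sigma : tensor R p).
Hypothesis sigma_gt0 : forall i, (0 < sigma i)%R.
Hypothesis Z_gauss : gaussian_noise Z sigma.

Let noise (w : Omega) : tensorT := fun i => Z i w.

Lemma measurable_noise : measurable_fun [set: Omega] noise.
Proof. by apply: measurable_to_tensor => i; exact: measurable_funP. Qed.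

Lemma noise_box B : (forall i, measurable (B i)) ->
  P (noise @^-1` box B) = \prod_i normal_prob 0 (sigma i) (B i).
Proof.
move=> mB; case: Z_gauss => indep law.
have -> : noise @^-1` box B = \bigcap_(i in [set` [set: midx p]%SET]) (Z i @^-1` B i).
  apply/seteqP; split => w Bw i; first by move=> _; exact: Bw.
  by apply: Bw => /=; rewrite finset.inE.
rewrite indep//; apply: eq_big => [i|i _]; first by rewrite finset.inE.
by rewrite -law.
Qed.

Lemma ge0_integral_noise_translate (h : tensor R p) (F : tensorT -> \bar R) :
  measurable_fun [set: tensorT] F -> (forall t, 0 <= F t) ->
  \int[P]_w F (fun i => Z i w + h i)%R =
  \int[P]_w (F (fun i => Z i w) * (likelihood sigma h (fun i => Z i w))%:E).
Proof.
move=> mF F0; have mZ := measurable_noise.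
have sigma0 i : sigma i != 0%R by rewrite gt_eqF.
have mlik := measurable_likelihood sigma h.
have mtr : measurable_fun [set: tensorT] (fun t : tensorT => (fun i => t i + h i)%R : tensorT).
  apply: measurable_to_tensor => i; apply: measurable_funD => //.
  exact: measurable_coord.
pose Ft : tensorT -> \bar R := fun t => F (fun i => t i + h i)%R.
pose Fl : tensorT -> \bar R := fun t => F t * (likelihood sigma h t)%:E.
have mFt : measurable_fun [set: tensorT] Ft by exact: (measurableT_comp mF mtr).
have mFl : measurable_fun [set: tensorT] Fl.
  by apply: emeasurable_funM => //; exact/measurable_EFinP.
have Fl0 t : 0 <= Fl t by rewrite mule_ge0// lee_fin likelihood_ge0.
have toP (G : tensorT -> \bar R) : measurable_fun [set: tensorT] G ->
    (forall t, 0 <= G t) ->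
    \int[pushforward P noise]_t G t = \int[P]_w G (fun i => Z i w).
  by move=> mG G0; rewrite (ge0_integral_pushforward mZ).
have Ft0 t : 0 <= Ft t by exact: F0.
rewrite -[LHS]/(\int[P]_w Ft (fun i => Z i w)) -[RHS]/(\int[P]_w Fl (fun i => Z i w)).
rewrite -(toP Ft)// -(toP Fl)//.
exact: (@ge0_integral_translate R p (pushforward P noise) sigma sigma0 noise_box h F mF F0).
Qed.

(** No integrability is assumed: the positive and negative parts are translated
    separately, and the likelihood ratio is nonnegative. *)
Lemma integral_noise_translate (h : tensor R p) (f : tensorT -> R) :
  measurable_fun [set: tensorT] f ->
  \int[P]_w (f (fun i => Z i w + h i)%R)%:E =
  \int[P]_w ((f (fun i => Z i w) * likelihood sigma h (fun i => Z i w))%R)%:E.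
Proof.
move=> mf; have mEf : measurable_fun [set: tensorT] (EFin \o f) by exact/measurable_EFinP.
rewrite [LHS]integralE [RHS]integralE.
have lik0 w : (0 <= likelihood sigma h (fun i => Z i w))%R by exact: likelihood_ge0.
congr (_ - _).
  transitivity (\int[P]_w ((EFin \o f)^\+ (fun i => Z i w + h i)%R)).
    by apply: eq_integral => w _; rewrite !funeposE.
  rewrite ge0_integral_noise_translate//; last exact: measurable_funepos.
  apply: eq_integral => w _; rewrite !funeposE/= EFinM.
  by rewrite maxe_pMl ?lee_fin// mul0e.
transitivity (\int[P]_w ((EFin \o f)^\- (fun i => Z i w + h i)%R)).
  by apply: eq_integral => w _; rewrite !funenegE.
rewrite ge0_integral_noise_translate//; last exact: measurable_funeneg.
apply: eq_integral => w _; rewrite !funenegE/= -mulNr EFinM.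
by rewrite maxe_pMl ?lee_fin// mul0e.
Qed.

End gaussian_noise_translation.

(** * The Hammersley-Chapman-Robbins inequality *)

Section square_integrable.
Local Open Scope ereal_scope.
Context d (T : measurableType d) (R : realType) (P : probability T R).

Lemma Lfun2_of_integral_sqr (f : T -> R) : measurable_fun [set: T] f ->
  \int[P]_w ((f w) ^+ 2)%:E < +oo -> f \in Lfun P 2%:E.
Proof.
move=> mf foo; rewrite inE; apply/andP; split; rewrite inE//=.
rewrite /finite_norm unlock poweR_lty//.
under eq_integral => w _ do rewrite poweR_EFin powR_mulrn// real_normK ?num_real//.
exact: foo.
Qed.

(** [covariance_le] bounds the covariance from above only; it is applied to [X]
    and to [- X]. *)
Lemma sqr_fine_covariance_le (X Y : T -> R) :
  X \in Lfun P 2%:E -> Y \in Lfun P 2%:E ->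
  ((fine (covariance P X Y)) ^+ 2 <= fine 'V_P[X] * fine 'V_P[Y])%R.
Proof.
move=> X2 Y2.
have Pfin : P setT \is a fin_num := fin_num_measure P _ measurableT.
have X1 := Lfun_subset12 Pfin X2; have Y1 := Lfun_subset12 Pfin Y2.
have XY1 := Lfun2_mul_Lfun1 X2 Y2.
have cov_fin := covariance_fin_num X1 Y1 XY1.
have NX2 : (\- X)%R \in Lfun P 2%:E by rewrite rpredN ?lee1n.
have := covariance_le X2 Y2; have := covariance_le NX2 Y2.
rewrite varianceN// covarianceNl//.
rewrite -(fineK cov_fin) -(fineK (variance_fin_num X2)).
rewrite -(fineK (variance_fin_num Y2)) /= -!EFinM !lee_fin.
set c := fine (covariance _ _ _); set a := fine _; set b := fine _ => cN c0.
have a0 : (0 <= a)%R by rewrite fine_ge0// variance_ge0.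
have b0 : (0 <= b)%R by rewrite fine_ge0// variance_ge0.
rewrite -[leRHS]sqr_sqrtr ?mulr_ge0// sqrtrM//.
rewrite -real_normK ?num_real// lerXn2r ?nnegrE ?mulr_ge0 ?sqrtr_ge0//.
by rewrite ler_norml; apply/andP; split => //; rewrite lerNl.
Qed.

End square_integrable.

Section hammersley_chapman_robbins.
Local Open Scope ereal_scope.
Context (R : realType) (p : 'I_3 -> nat) (d : measure_display)
  (Omega : measurableType d) (P : probability Omega R).
Local Notation tensorT := (g_sigma_algebraType (@cylinders R p)).
Variables (Z : midx p -> {RV P >-> R}) (sigma : tensor R p).
Hypothesis sigma_gt0 : forall i, (0 < sigma i)%R.
Hypothesis Z_gauss : gaussian_noise Z sigma.
Variable h : tensor R p.

Let L (w : Omega) : R := likelihood sigma h (fun i => Z i w).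
Let energy : R := (\sum_i h i ^+ 2 / sigma i ^+ 2)%R.

(** Under the translated law the likelihood ratio is multiplied by a constant,
    which is therefore its second moment under the original law. *)
Lemma likelihood_translate (t : tensor R p) :
  likelihood sigma h (fun i => t i + h i)%R =
  (likelihood sigma h t * expR energy)%R.
Proof.
rewrite /likelihood /energy expR_sum -big_split/=; apply: eq_bigr => i _.
rewrite /gauss_tilt -expRD; congr expR; field.
by rewrite gt_eqF.
Qed.

Let mL : measurable_fun [set: Omega] L.
Proof.
exact: (measurableT_comp (measurable_likelihood sigma h) (measurable_noise Z)).
Qed.

Lemma integral_likelihood : \int[P]_w (L w)%:E = 1.
Proof.
have := @ge0_integral_noise_translate _ _ _ _ P Z sigma sigma_gt0 Z_gauss h
  (fun=> 1) (measurable_cst _) (fun=> lee01).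
rewrite integral_cst//= probability_setT mule1 => ->.
by apply: eq_integral => w _; rewrite mul1e.
Qed.

Lemma integral_likelihood_sqr : \int[P]_w ((L w) ^+ 2)%:E = (expR energy)%:E.
Proof.
have mlik := measurable_likelihood sigma h.
transitivity (\int[P]_w (likelihood sigma h (fun i => Z i w + h i)%R)%:E).
  by rewrite (integral_noise_translate sigma_gt0 Z_gauss)//;
    apply: eq_integral => w _; rewrite expr2.
under eq_integral do rewrite likelihood_translate EFinM.
rewrite ge0_integralZr// ?integral_likelihood ?mul1e//.
- exact/measurable_EFinP.
- by move=> w _; rewrite lee_fin likelihood_ge0.
Qed.

Lemma likelihood_Lfun2 : L \in Lfun P 2%:E.
Proof. by apply: Lfun2_of_integral_sqr => //; rewrite integral_likelihood_sqr ltry. Qed.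

(** The change of mean is the covariance with the likelihood ratio, whose
    variance is [expR energy - 1]. *)
Lemma hammersley_chapman_robbins (f : tensorT -> R) :
  measurable_fun [set: tensorT] f ->
  (fun w => f (fun i => Z i w)) \in Lfun P 2%:E ->
  ((fine 'E_P[fun w => f (fun i => Z i w + h i)%R]
    - fine 'E_P[fun w => f (fun i => Z i w)]) ^+ 2
   <= fine 'V_P[fun w => f (fun i => Z i w)] * (expR energy - 1))%R.
Proof.
move=> mf f2; set Y := fun w => f (fun i => Z i w).
have L2 := likelihood_Lfun2.
have Pfin : P setT \is a fin_num := fin_num_measure P _ measurableT.
have Y1 := Lfun_subset12 Pfin f2; have L1 := Lfun_subset12 Pfin L2.
have YL1 := Lfun2_mul_Lfun1 f2 L2.
have EL : 'E_P[L] = 1 by rewrite unlock integral_likelihood.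
have VL : fine 'V_P[L] = (expR energy - 1)%R.
  rewrite varianceE// EL expe2 mule1 unlock /=.
  rewrite (_ : \int[P]_w _ = (expR energy)%:E)//.
  by rewrite -integral_likelihood_sqr.
have cov : covariance P Y L =
    'E_P[fun w => f (fun i => Z i w + h i)%R] - 'E_P[Y].
  rewrite covarianceE// EL mule1; congr (_ - _).
  by rewrite unlock (integral_noise_translate sigma_gt0 Z_gauss).
have EYh : 'E_P[fun w => f (fun i => Z i w + h i)%R] = 'E_P[(Y * L)%R].
  by rewrite unlock (integral_noise_translate sigma_gt0 Z_gauss).
have EYh_fin : 'E_P[fun w => f (fun i => Z i w + h i)%R] \is a fin_num.
  by rewrite EYh; exact: expectation_fin_num.
rewrite -VL -fineB//; last exact: expectation_fin_num.
by rewrite -cov sqr_fine_covariance_le.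
Qed.

End hammersley_chapman_robbins.

(** * Matricization and change of one factor *)

Section matricization.
Context (R : realType) (p : 'I_3 -> nat) (k : 'I_3).

Lemma col_index_subproof (i : midx p) :
  (i (ordS k) * p (ordS (ordS k)) + i (ordS (ordS k))
     < p (ordS k) * p (ordS (ordS k)))%N.
Proof.
have h1 := ltn_ord (i (ordS k)); have h2 := ltn_ord (i (ordS (ordS k))).
apply: (@leq_trans ((i (ordS k)).+1 * p (ordS (ordS k)))); last by rewrite leq_mul2r h1 orbT.
by rewrite mulSn addnC ltn_add2r.
Qed.

(** The column of the mode-[k] matricization that holds the entry [i]. *)
Definition col_index (i : midx p) : 'I_(p (ordS k) * p (ordS (ordS k))) :=
  Ordinal (col_index_subproof i).

Lemma ord3_cases (j : 'I_3) : [\/ j = k, j = ordS k | j = ordS (ordS k)].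
Proof.
by case: k j => [[|[|[|//]]] ?] [[|[|[|//]]] ?];
  [constructor 1|constructor 2|constructor 3
  |constructor 3|constructor 1|constructor 2
  |constructor 2|constructor 3|constructor 1]; apply/val_inj.
Qed.

Lemma index_inj (i i' : midx p) :
  i k = i' k -> col_index i = col_index i' -> i = i'.
Proof.
move=> ik /(congr1 val) /= icol.
have q_gt0 : (0 < p (ordS (ordS k)))%N by apply: leq_ltn_trans (ltn_ord (i _)).
have i1 : i (ordS k) = i' (ordS k).
  apply/val_inj => /=; move/(congr1 (fun x => x %/ p (ordS (ordS k)))%N): icol.
  by rewrite !divnMDl// !divn_small ?ltn_ord// !addn0.
have i2 : i (ordS (ordS k)) = i' (ordS (ordS k)).
  by apply/val_inj/eqP; rewrite /= -(eqn_add2l (i (ordS k) * p (ordS (ordS k)))) {2}i1 icol.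
by apply/ffunP => j; case: (ord3_cases j) => ->.
Qed.

Lemma unfoldE (T : tensor R p) (i : midx p) : unfold k T (i k) (col_index i) = T i.
Proof.
rewrite mxE (big_pred1 i)// => i'.
apply/andP/eqP => [[/eqP ik icol]|->//].
by apply: index_inj => //; apply/val_inj/eqP; rewrite eq_sym.
Qed.

(** The trace is the squared Frobenius norm, and distinct multi-indices label
    distinct entries of the matricization. *)
Lemma sum_sqr_index_le (M : 'M[R]_(p k, p (ordS k) * p (ordS (ordS k)))) :
  \sum_(i : midx p) M (i k) (col_index i) ^+ 2 <= \tr (M *m M^T).
Proof.
have -> : \tr (M *m M^T) =
    \sum_(ac in [set: 'I_(p k) * 'I_(p (ordS k) * p (ordS (ordS k)))]%SET)
      M ac.1 ac.2 ^+ 2.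
  rewrite /mxtrace; under eq_bigr do rewrite mxE.
  rewrite pair_bigA/=; apply: eq_big => [ac|[a c] _]; first by rewrite finset.inE.
  by rewrite mxE.
pose e (i : midx p) := (i k, col_index i).
have e_inj : injective e.
  by move=> i i' ee; apply: index_inj; [exact: (congr1 fst ee)|exact: (congr1 snd ee)].
rewrite (finset.big_setID (e @: [set: midx p])%SET)/= finset.setTI big_imset/=; last first.
  by move=> i i' _ _; exact: e_inj.
rewrite -[leLHS]addr0 lerD//; last by apply: sumr_ge0 => ac _; exact: sqr_ge0.
by rewrite le_eqVlt; apply/orP; left; apply/eqP; apply: eq_bigl => i; rewrite finset.inE.
Qed.

End matricization.

Section signal_of_factor.
Context (R : realType) (p r : 'I_3 -> nat) (th : tucker_param R p r) (k : 'I_3).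

(** The contraction of the core with all factors but the [k]-th one: the signal
    is linear in the [k]-th factor with these coefficients. *)
Let rest (i : midx p) (b : 'I_(r k)) : R :=
  \sum_(a : midx r | a k == b) core th a * \prod_(j < 3 | j != k) fac th j (i j) (a j).

Let signal_set_fac_sum (W : 'M[R]_(p k, r k)) (i : midx p) :
  signal (set_fac th W) i = \sum_b W (i k) b * rest i b.
Proof.
rewrite /signal (partition_big (fun a : midx r => a k) predT)//=.
apply: eq_bigr => b _; rewrite /rest mulr_sumr; apply: eq_bigr => a /eqP ak.
rewrite (bigD1 k)//= dfwithin ak mulrCA; congr (_ * (_ * _)).
by apply: eq_bigr => j jk; rewrite dfwithout// eq_sym.
Qed.

Let set_row (i : midx p) (x : 'I_(p k)) : midx p := finfun (dfwith i k x).

Lemma signal_set_fac_id : signal (set_fac th (fac th k)) = signal th.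
Proof.
apply/funext => i; apply: eq_bigr => a _; congr (_ * _).
by apply: eq_bigr => j _ /=; case: dfwithP.
Qed.

(** Multiplying [unfold k (signal th) = U *m N] on the left by [U^T] shows that
    the coefficients of the [k]-th factor are the entries of [N]; they do not
    depend on that factor. *)
Lemma signal_set_facE lam V (W : 'M[R]_(p k, r k)) (i : midx p) :
  is_rank_svd (unfold k (signal th)) (fac th k) lam V ->
  signal (set_fac th W) i = (W *m (diag_mx lam *m V^T)) (i k) (col_index k i).
Proof.
case=> UU _ _ _ svd; rewrite signal_set_fac_sum mxE; apply: eq_bigr => b _.
congr (_ * _); set N := diag_mx lam *m V^T.
have row_eq x : \sum_c fac th k x c * rest i c =
    \sum_c fac th k x c * N c (col_index k i).
  have ix : set_row i x k = x by rewrite ffunE dfwithin.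
  have ic : col_index k (set_row i x) = col_index k i.
    by apply/val_inj; rewrite /= !ffunE !dfwithout//; case: (k) => -[|[|[|//]]] ?.
  have restx : rest (set_row i x) =1 rest i.
    move=> c; apply: eq_bigr => a _; congr (_ * _); apply: eq_bigr => j jk.
    by rewrite ffunE dfwithout// eq_sym.
  transitivity (signal th (set_row i x)).
    rewrite -signal_set_fac_id signal_set_fac_sum ix.
    by apply: eq_bigr => c _; rewrite restx.
  by rewrite -(unfoldE k) svd -mulmxA mxE ix ic.
pose u := \col_c rest i c.
have : fac th k *m u = fac th k *m col (col_index k i) N.
  apply/colP => x; rewrite !mxE.
  under eq_bigr do rewrite mxE.
  by under [RHS]eq_bigr do rewrite mxE.
move/(congr1 (mulmx (fac th k)^T)); rewrite !mulmxA UU !mul1mx.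
by move/colP/(_ b); rewrite !mxE.
Qed.

End signal_of_factor.

(** * A curve of orthonormal factors *)

Section stiefel_curve.
Context (R : realType) (P s : nat) (U : 'M[R]_(P, s)) (m : 'I_P) (w : 'cV[R]_s).
Hypothesis U_orth : orthonormal_cols U.

Let G : R := 1 - \sum_a U m a ^+ 2.
Let A : R := \sum_a w a 0 ^+ 2.
Let g : 'cV[R]_P := delta_mx m 0 - U *m (row m U)^T.

(** The term in [t] is the second-order correction that keeps the curve
    orthonormal; [curve_speed] is the rational parametrization of the circle
    drawn in the plane of [g] and [U w]. *)
Definition curve_dir (t : R) : 'M[R]_(P, s) :=
  (g - (t * G) *: (U *m w)) *m w^T.

Definition curve_speed (t : R) : R := 2 * t / (1 + t ^+ 2 * A * G).

Definition stiefel_curve (t : R) : 'M[R]_(P, s) :=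
  U + curve_speed t *: curve_dir t.

Let row_delta : (row m U) = (delta_mx m 0)^T *m U.
Proof. by rewrite rowE trmx_delta. Qed.

Let Ug : U^T *m g = 0.
Proof. by rewrite mulmxBr mulmxA U_orth mul1mx row_delta trmx_mul trmxK subrr. Qed.

Let sqr_norm n (x : 'cV[R]_n) : x^T *m x = (\sum_a x a 0 ^+ 2)%:M.
Proof.
apply/matrixP => i j; rewrite !ord1 !mxE eqxx mulr1n.
by apply: eq_bigr => a _; rewrite mxE -expr2.
Qed.

Let gg : g^T *m g = G%:M.
Proof.
rewrite {1}/g [(_ - _)^T]linearB/= mulmxBl trmx_mul trmxK -mulmxA Ug mulmx0 subr0.
rewrite mulmxBr trmx_delta -!rowE.
apply/matrixP => i j; rewrite !ord1 !mxE !eqxx mulr1n.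
by congr (_ - _); apply: eq_bigr => a _; rewrite !mxE expr2.
Qed.

Lemma row_defect_ge0 : 0 <= G.
Proof.
have := congr1 (fun M : 'M[R]_1 => M 0 0) gg; rewrite sqr_norm !mxE eqxx !mulr1n => <-.
by apply: sumr_ge0 => a _; exact: sqr_ge0.
Qed.

Let A_ge0 : 0 <= A. Proof. by apply: sumr_ge0 => a _; exact: sqr_ge0. Qed.

Lemma curve_denominator_gt0 t : 0 < 1 + t ^+ 2 * A * G.
Proof.
apply: (lt_le_trans ltr01); rewrite lerDl mulr_ge0 ?row_defect_ge0//.
by rewrite mulr_ge0 ?sqr_ge0.
Qed.

Let x (t : R) : 'cV[R]_P := g - (t * G) *: (U *m w).

Let Ux t : U^T *m x t = - (t * G) *: w.
Proof.
by rewrite mulmxBr Ug sub0r -scalemxAr mulmxA U_orth mul1mx scaleNr.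
Qed.

Let xx t : (x t)^T *m x t = (G * (1 + t ^+ 2 * A * G))%:M.
Proof.
rewrite {1}/x [(_ - _)^T]linearB/= linearZ/= mulmxBl -scalemxAl trmx_mul -mulmxA Ux.
have -> : g^T *m x t = G%:M.
  rewrite mulmxBr gg -scalemxAr mulmxA -[g^T *m U]trmxK trmx_mul trmxK Ug.
  by rewrite trmx0 mul0mx scaler0 subr0.
rewrite -scalemxAr sqr_norm scalerA -/A.
apply/matrixP => i j; rewrite !ord1 !mxE eqxx !mulr1n; ring.
Qed.

Lemma stiefel_curve_orthonormal t : orthonormal_cols (stiefel_curve t).
Proof.
rewrite /orthonormal_cols /stiefel_curve /curve_dir -/(x t).
set b := curve_speed t.
rewrite [(_ + _)^T]linearD/= [(_ *: _)^T]linearZ/= mulmxDl !mulmxDr U_orth trmx_mul trmxK.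
have Uxw : U^T *m (x t *m w^T) = - (t * G) *: (w *m w^T).
  by rewrite mulmxA Ux scalemxAl.
have wxU : w *m (x t)^T *m U = - (t * G) *: (w *m w^T).
  rewrite -mulmxA -[(x t)^T *m U]trmxK trmx_mul trmxK Ux linearZ/=.
  by rewrite scalemxAr.
have wxxw : w *m (x t)^T *m (x t *m w^T) =
    (G * (1 + t ^+ 2 * A * G)) *: (w *m w^T).
  by rewrite mulmxA -(mulmxA w) xx mul_mx_scalar scalemxAl.
rewrite -!scalemxAr -!scalemxAl Uxw wxU wxxw !scalerA -addrA -[RHS]addr0.
congr (_ + _).
rewrite -!scalerDl [X in X *: _](_ : _ = 0) ?scale0r//.
rewrite /b /curve_speed; field.
by rewrite gt_eqF// curve_denominator_gt0.
Qed.

Lemma curve_dir_row t (v : 'cV[R]_s) :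
  \sum_a v a 0 * curve_dir t m a =
  G * (1 - t * \sum_a U m a * w a 0) * \sum_a v a 0 * w a 0.
Proof.
rewrite mulr_sumr; apply: eq_bigr => a _.
rewrite /curve_dir mxE big_ord1 !mxE !eqxx.
have -> : \sum_j U m j * (row m U)^T j 0 = \sum_j U m j ^+ 2.
  by apply: eq_bigr => j _; rewrite !mxE expr2.
rewrite -/G; ring.
Qed.

(** The direction has rank one, so its energy is a product of squared norms. *)
Lemma curve_dir_energy t (D : 'M[R]_s) :
  \tr (curve_dir t *m D *m (curve_dir t *m D)^T) =
  G * (1 + t ^+ 2 * A * G) * \tr (w^T *m D *m (w^T *m D)^T).
Proof.
set y := w^T *m D.
have -> : curve_dir t *m D = x t *m y by rewrite -mulmxA.
rewrite trmx_mul; move: y => y.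
rewrite mulmxA mxtrace_mulC -mulmxA (mulmxA (x t)^T) xx.
by rewrite mul_scalar_mx linearZ.
Qed.

End stiefel_curve.

(** * Limit along the curve *)

Section limits_along_curve.
Context (R : realType).

Lemma cvg_curve_denominator (c : R) : 1 + t ^+ 2 * c @[t --> (0 : R)] --> (1 : R).
Proof.
rewrite -[X in _ --> X](_ : 1 + 0 ^+ 2 * c = 1) ; last by rewrite expr0n mul0r addr0.
apply: (@cvgD _ R^o); first exact: cvg_cst.
by apply: cvgM; [exact: exprn_continuous|exact: cvg_cst].
Qed.

Lemma cvg_curve_speed (c : R) :
  2 * t / (1 + t ^+ 2 * c) @[t --> (0 : R)] --> (0 : R).
Proof.
rewrite -[X in _ --> X](_ : 2 * 0 / 1 = 0 :> R) ; last by rewrite mulr0 mul0r.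
apply: cvgM; first by apply: cvgM; [exact: cvg_cst|exact: cvg_id].
by apply: cvgV => //; exact: cvg_curve_denominator.
Qed.

Lemma cvg_stiefel_curve (P s : nat) (U : 'M[R]_(P, s)) (m : 'I_P) (w : 'cV[R]_s) :
  stiefel_curve U m w t @[t --> (0 : R)] --> U.
Proof.
rewrite -[X in _ --> X]addr0; apply: cvgD; first exact: cvg_cst.
rewrite -[X in _ --> X](scale0r (curve_dir U m w 0)).
apply: cvgZ.
  rewrite /curve_speed; under eq_fun do rewrite -(mulrA (_ ^+ 2)).
  exact: cvg_curve_speed.
have dirE t : curve_dir U m w t =
   (delta_mx m 0 - U *m (row m U)^T) *m w^T - t *: ((1 - \sum_a U m a ^+ 2) *: (U *m w *m w^T)).
  by rewrite /curve_dir mulmxBl -scalemxAl scalerA.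
rewrite (funext dirE : curve_dir U m w = _).
apply: cvgB; first exact: cvg_cst.
by apply: cvgZ; [exact: cvg_id|exact: cvg_cst].
Qed.


(** Bounding [exp y - 1] by [y * exp y], both sides are divisible by the squared
    speed, and what remains is continuous at 0. *)
Lemma chapman_robbins_limit (V s2 G A q u : R) :
  0 < s2 -> 0 < G -> 0 <= A -> 0 < q -> 0 <= V ->
  (\forall t \near (0 : R),
     let b := 2 * t / (1 + t ^+ 2 * A * G) in
     (b * (G * (1 - t * u) * q)) ^+ 2 <=
     V * (expR (b ^+ 2 * (G * (1 + t ^+ 2 * A * G) * q) / s2) - 1)) ->
  s2 * (G * q) <= V.
Proof.
move=> s2_gt0 G_gt0 A_ge0 q_gt0 V_ge0 bound.
pose den t : R := 1 + t ^+ 2 * (A * G).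
pose b t : R := 2 * t / den t.
pose y t : R := b t ^+ 2 * (G * den t * q) / s2.
have {}bound : \forall t \near (0 : R),
    (b t * (G * (1 - t * u) * q)) ^+ 2 <= V * (expR (y t) - 1).
  by apply: filterS bound => t; rewrite /= /y /b /den -!(mulrA (t ^+ 2)).
have den_gt0 t : 0 < den t.
  by rewrite ltr_pwDl// mulr_ge0 ?sqr_ge0// mulr_ge0// ltW.
have cvgden : den t @[t --> (0 : R)] --> (1 : R) by exact: cvg_curve_denominator.
have cvgy : y t @[t --> (0 : R)] --> (0 : R).
  rewrite -[X in _ --> X](_ : 0 ^+ 2 * (G * 1 * q) / s2 = 0); last first.
    by rewrite expr0n !mul0r.
  apply: cvgM; last exact: cvg_cst.
  apply: cvgM.
    by rewrite expr2; under eq_fun do rewrite expr2; apply: cvgM; exact: cvg_curve_speed.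
  by apply: cvgM; [apply: cvgM; [exact: cvg_cst|]|exact: cvg_cst].
have lim_lhs : s2 * (G * q) * (1 - t * u) ^+ 2 @[t --> (0 : R)^'] --> s2 * (G * q).
  apply: cvg_within_filter.
  suff : s2 * (G * q) * (1 - t * u) ^+ 2 @[t --> (0 : R)] -->
      s2 * (G * q) * (1 - 0 * u) ^+ 2 by rewrite mul0r subr0 expr1n mulr1.
  apply: cvgM; first exact: cvg_cst.
  have cvg1 : 1 - t * u @[t --> (0 : R)] --> 1 - 0 * u.
    apply: (@cvgB _ R^o); first exact: cvg_cst.
    by apply: cvgM; [exact: cvg_id|exact: cvg_cst].
  by rewrite [in X in _ --> X]expr2; under eq_fun do rewrite expr2; exact: cvgM.
have lim_rhs : V * (den t * expR (y t)) @[t --> (0 : R)^'] --> V.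
  apply: cvg_within_filter.
  suff : V * (den t * expR (y t)) @[t --> (0 : R)] --> V * (1 * expR 0).
    by rewrite expR0 !mulr1.
  apply: cvgM; first exact: cvg_cst.
  apply: cvgM => //.
  by apply: (cvg_comp y expR cvgy); exact: continuous_expR.
apply: (ler_cvg_to lim_lhs lim_rhs).
near=> t.
have t_neq0 : t != 0 by near: t; exact: nbhs_dnbhs_neq.
have : (b t * (G * (1 - t * u) * q)) ^+ 2 <= V * (expR (y t) - 1).
  by near: t; apply: nbhs_dnbhs.
(* This is [1 - y <= exp (- y)] multiplied by [exp y]. *)
have expR_sub1 : expR (y t) - 1 <= y t * expR (y t).
  have := expR_ge1Dx (- y t); rewrite expRN -(ler_pM2r (expR_gt0 (y t))).
  by rewrite mulVf ?gt_eqF ?expR_gt0// => h; lra.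
move/le_trans => /(_ _ (ler_wpM2l V_ge0 expR_sub1)) main.
have b_gt0 : 0 < b t ^+ 2 * (G * q) / s2.
  have b_neq0 : b t != 0.
    by rewrite /b mulf_neq0 ?invr_eq0 ?(gt_eqF (den_gt0 t))// mulf_neq0 ?pnatr_eq0.
  by rewrite divr_gt0// mulr_gt0 ?(mulr_gt0 G_gt0)// exprn_even_gt0.
rewrite -(ler_pM2l b_gt0).
rewrite [leLHS](_ : _ = (b t * (G * (1 - t * u) * q)) ^+ 2); last first.
  by field; rewrite gt_eqF.
rewrite (le_trans main)// le_eqVlt; apply/orP; left; apply/eqP.
by rewrite /y; field; rewrite gt_eqF.
Unshelve. all: by end_near. Qed.

End limits_along_curve.

(** * The variance bound in fixed dimension *)

Section linear_combinations.
Context d (T : measurableType d) (R : realType) (P : probability T R).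

Lemma Lfun_lincomb (I : Type) (s : seq I) (c : I -> R) (Y : I -> T -> R) (e : R) :
  1 <= e -> (forall a, Y a \in Lfun P e%:E) ->
  (fun w => \sum_(a <- s) c a * Y a w) \in Lfun P e%:E.
Proof.
move=> e1 Ye; elim: s => [|a s IHs].
  by under eq_fun do rewrite big_nil; exact: Lfun_cst.
have -> : (fun w => \sum_(b <- a :: s) c b * Y b w) =
    (c a \o* Y a \+ (fun w => \sum_(b <- s) c b * Y b w)).
  by apply/funext => w; rewrite big_cons/= mulrC.
by rewrite rpredD//= ?Lfun_scale// lee_fin.
Qed.

Lemma fine_expectation_lincomb (I : Type) (s : seq I) (c : I -> R)
    (Y : I -> T -> R) : (forall a, Y a \in Lfun P 1) ->
  fine 'E_P[fun w => \sum_(a <- s) c a * Y a w] =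
  \sum_(a <- s) c a * fine 'E_P[Y a].
Proof.
move=> Y1; elim: s => [|a s IHs].
  under eq_fun do rewrite big_nil.
  by rewrite expectation_cst big_nil.
have -> : (fun w => \sum_(b <- a :: s) c b * Y b w) =
    (c a \o* Y a \+ (fun w => \sum_(b <- s) c b * Y b w)).
  by apply/funext => w; rewrite big_cons/= mulrC.
have S1 := @Lfun_lincomb _ s c Y 1 (lexx _) Y1.
have cY1 : c a \o* Y a \in Lfun P 1 by exact: Lfun_scale.
rewrite expectationD// fineD ?expectation_fin_num// IHs big_cons.
by rewrite expectationZl// fineM// expectation_fin_num.
Qed.

Lemma fine_covariance_lincomb (I : Type) (s : seq I) (c : I -> R)
    (Y : I -> T -> R) (X : T -> R) :
  (forall a, Y a \in Lfun P 2%:E) -> X \in Lfun P 2%:E ->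
  fine (covariance P (fun w => \sum_(a <- s) c a * Y a w) X) =
  \sum_(a <- s) c a * fine (covariance P (Y a) X).
Proof.
move=> Y2 X2; elim: s => [|a s IHs].
  under eq_fun do rewrite big_nil.
  by rewrite covariance_cst_l big_nil.
have Pfin : P setT \is a fin_num := fin_num_measure P _ measurableT.
have l12 f : f \in Lfun P 2%:E -> f \in Lfun P 1 by exact: Lfun_subset12.
have cov_fin f g : f \in Lfun P 2%:E -> g \in Lfun P 2%:E ->
    covariance P f g \is a fin_num.
  move=> f2 g2.
  exact: (covariance_fin_num (l12 _ f2) (l12 _ g2) (Lfun2_mul_Lfun1 f2 g2)).
have -> : (fun w => \sum_(b <- a :: s) c b * Y b w) =
    (c a \o* Y a \+ (fun w => \sum_(b <- s) c b * Y b w)).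
  by apply/funext => w; rewrite big_cons/= mulrC.
have S2 := @Lfun_lincomb _ s c Y 2 (ler1n _ 2) Y2.
have cY2 : c a \o* Y a \in Lfun P 2%:E by rewrite Lfun_scale// ler1n.
rewrite covarianceDl// fineD ?cov_fin// IHs big_cons.
rewrite (covarianceZl _ (l12 _ (Y2 a)) (l12 _ X2) (Lfun2_mul_Lfun1 (Y2 a) X2)).
by rewrite fineM// cov_fin.
Qed.

Lemma covariance_mx_quad (s : nat) (Y : T -> 'cV[R]_s) (v : 'cV[R]_s) :
  (forall a, (fun w => Y w a 0) \in Lfun P 2%:E) ->
  (v^T *m covariance_mx P Y *m v) 0 0 =
  fine 'V_P[fun w => \sum_a v a 0 * Y w a 0].
Proof.
move=> Y2; set S := fun w => _.
have S2 : S \in Lfun P 2%:E.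
  by apply: (@Lfun_lincomb _ _ (fun a => v a 0) (fun a w => Y w a 0)); rewrite ?ler1n.
rewrite /variance {1}/S.
rewrite (@fine_covariance_lincomb _ _ (fun a => v a 0) (fun a w => Y w a 0))//.
rewrite -mulmxA mxE; apply: eq_bigr => a _; rewrite !mxE; congr (_ * _).
rewrite covarianceC (@fine_covariance_lincomb _ _ (fun a => v a 0) (fun a w => Y w a 0))//.
by apply: eq_bigr => b _; rewrite mxE mulrC covarianceC.
Qed.

End linear_combinations.

Section row_bound.
Context (R : realType) (p r : 'I_3 -> nat) (d : measure_display)
  (Omega : measurableType d) (P : probability Omega R).
Local Notation tensorT := (g_sigma_algebraType (@cylinders R p)).
Variables (th : tucker_param R p r) (k : 'I_3) (m : 'I_(p k)).
Variables (lam : 'rV[R]_(r k)) (V : 'M[R]_(p (ordS k) * p (ordS (ordS k)), r k)).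
Hypothesis svd : is_rank_svd (unfold k (signal th)) (fac th k) lam V.
Variables (Z : midx p -> {RV P >-> R}) (sigma : tensor R p) (smin : R).
Hypothesis smin_gt0 : 0 < smin.
Hypothesis smin_le : forall i, smin <= sigma i.
Hypothesis Z_gauss : gaussian_noise Z sigma.
Variables (Theta : set (tucker_param R p r)) (X : tensor R p -> 'cV[R]_(r k)).
Hypothesis Theta_th : parameter_space Theta th k.
Hypothesis mX : measurable_estimator X.
Hypothesis X_unbiased : unbiased Z Theta m X.
Hypothesis X2 : forall a, (fun w => X (observe (signal th) Z w) a 0) \in Lfun P 2%:E.

Let lam_gt0 a : 0 < lam 0 a. Proof. by case: svd. Qed.
Let U := fac th k.
Let U_orth : orthonormal_cols U. Proof. by case: svd. Qed.
Let sigma_gt0 i : 0 < sigma i. Proof. exact: lt_le_trans (smin_le i). Qed.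

(** Right multiplication by [V^T] preserves the Frobenius norm because the
    columns of [V] are orthonormal. *)
Lemma signal_energy_le (W : 'M[R]_(p k, r k)) :
  \sum_i (signal (set_fac th W) i - signal th i) ^+ 2 / sigma i ^+ 2 <=
  \tr ((W - U) *m diag_mx lam *m ((W - U) *m diag_mx lam)^T) / smin ^+ 2.
Proof.
have VV : V^T *m V = 1%:M by case: svd.
set N := (W - U) *m diag_mx lam.
have -> : N *m N^T = N *m V^T *m (N *m V^T)^T.
  by move: N => N; rewrite trmx_mul trmxK mulmxA -(mulmxA N) VV mulmx1.
rewrite ler_pdivlMr ?exprn_gt0//; apply: le_trans (sum_sqr_index_le _).
rewrite mulr_suml; apply: ler_sum => i _.
rewrite -{1}(signal_set_fac_id th k) !(signal_set_facE _ _ svd).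
have -> : (N *m V^T) (i k) (col_index k i) =
   (W *m (diag_mx lam *m V^T)) (i k) (col_index k i) -
   (U *m (diag_mx lam *m V^T)) (i k) (col_index k i).
  by rewrite /N -mulmxA mulmxBl !mxE.
rewrite mulrAC -mulrA ler_piMr ?sqr_ge0// ler_pdivrMr ?exprn_gt0// mul1r.
by rewrite lerXn2r ?nnegrE ?(ltW smin_gt0) ?(ltW (sigma_gt0 i)).
Qed.

Variable v : 'cV[R]_(r k).
Let Y (w : Omega) : R := \sum_a v a 0 * X (observe (signal th) Z w) a 0.

Lemma estimator_hcr (W : 'M[R]_(p k, r k)) :
  Theta (set_fac th U) -> Theta (set_fac th W) ->
  (\sum_a v a 0 * (W - U) m a) ^+ 2 <=
  fine 'V_P[Y] * (expR (\tr ((W - U) *m diag_mx lam *m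
     ((W - U) *m diag_mx lam)^T) / smin ^+ 2) - 1).
Proof.
move=> ThU ThW; pose h : tensor R p := fun i => signal (set_fac th W) i - signal th i.
pose f : tensorT -> R := fun t => \sum_a v a 0 * X (fun i => signal th i + t i) a 0.
have mtr : measurable_fun [set: tensorT]
    (fun t : tensorT => (fun i => signal th i + t i) : tensorT).
  by apply: measurable_to_tensor => i; apply: measurable_funD => //; exact: measurable_coord.
have mf : measurable_fun [set: tensorT] f.
  apply: measurable_sum => a; apply: measurable_funM => //.
  exact: (measurableT_comp (mX a) mtr).
have Y2 : Y \in Lfun P 2%:E.
  apply: (@Lfun_lincomb _ _ _ P _ _ (fun a => v a 0)
    (fun a w => X (observe (signal th) Z w) a 0)) => //.
  by rewrite ler1n.
have meanE (W' : 'M[R]_(p k, r k)) : Theta (set_fac th W') ->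
    fine 'E_P[fun w => \sum_a v a 0 *
       X (observe (signal (set_fac th W')) Z w) a 0] = \sum_a v a 0 * W' m a.
  move=> ThW'.
  rewrite (@fine_expectation_lincomb _ _ _ P _ _ (fun a => v a 0)
    (fun a w => X (observe (signal (set_fac th W')) Z w) a 0)).
    apply: eq_bigr => a _; have [_ ->] := X_unbiased ThW' a.
    by rewrite /= dfwithin.
  by move=> a; have [] := X_unbiased ThW' a.
have := hammersley_chapman_robbins sigma_gt0 Z_gauss h mf Y2.
rewrite (_ : (fun w => f (fun i => Z i w + h i)) =
    fun w => \sum_a v a 0 * X (observe (signal (set_fac th W)) Z w) a 0); last first.
  apply/funext => w; apply: eq_bigr => a _; congr (_ * X _ a 0).
  by apply/funext => i; rewrite /h /observe; ring.
rewrite (_ : (fun w => f (fun i => Z i w)) = Y)//.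
rewrite meanE// {1}/Y -(signal_set_fac_id th k) meanE//.
rewrite (_ : _ - _ = \sum_a v a 0 * (W - U) m a); last first.
  by rewrite -sumrB; apply: eq_bigr => a _; rewrite !mxE mulrBr.
move=> /le_trans; apply; rewrite ler_wpM2l ?fine_ge0 ?variance_ge0// lerD2r ler_expR.
exact: signal_energy_le.
Qed.

(** With [w = D^-2 v], at speed [b] the change of mean is [b G q] and the energy
    of the signal [b^2 G q] at first order, so that their quotient is [G q]. *)
Lemma variance_row_ge :
  smin ^+ 2 * ((1 - \sum_a U m a ^+ 2) * \sum_a (v a 0 / lam 0 a) ^+ 2) <=
  fine 'V_P[Y].
Proof.
set q := \sum_a (v a 0 / lam 0 a) ^+ 2; set G := 1 - _.
have V_ge0 : 0 <= fine 'V_P[Y] by rewrite fine_ge0// variance_ge0.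
have G_ge0 : 0 <= G by exact: row_defect_ge0.
have q_ge0 : 0 <= q by apply: sumr_ge0 => a _; exact: sqr_ge0.
have [->|G_neq0] := eqVneq G 0; first by rewrite mul0r mulr0.
have [->|q_neq0] := eqVneq q 0; first by rewrite !mulr0.
pose w : 'cV[R]_(r k) := \col_a (v a 0 / lam 0 a ^+ 2).
have vw : \sum_a v a 0 * w a 0 = q.
  by apply: eq_bigr => a _; rewrite mxE; field; rewrite gt_eqF.
have wD : \tr (w^T *m diag_mx lam *m (w^T *m diag_mx lam)^T) = q.
  rewrite /mxtrace big_ord1 mxE; apply: eq_bigr => a _.
  by rewrite mul_mx_diag !mxE; field; rewrite gt_eqF.
apply: (@chapman_robbins_limit _ _ _ _ (\sum_a w a 0 ^+ 2) _
  (\sum_a U m a * w a 0)) => //.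
- by rewrite exprn_gt0.
- by rewrite lt0r G_neq0.
- by apply: sumr_ge0 => a _; exact: sqr_ge0.
- by rewrite lt0r q_neq0.
have [_ nearU] := Theta_th.
have ThU : Theta (set_fac th U) by exact: (nbhs_singleton nearU).
have near0 : \forall t \near (0 : R), orthonormal_cols (stiefel_curve U m w t) ->
    Theta (set_fac th (stiefel_curve U m w t)).
  exact: (@cvg_stiefel_curve _ _ _ U m w _ nearU).
apply: filterS near0 => t /(_ (stiefel_curve_orthonormal m w U_orth t)) ThW.
have := estimator_hcr ThU ThW.
rewrite /stiefel_curve [U + _]addrC addrK -scalemxAl [(_ *: _)^T]linearZ/=.
rewrite -scalemxAl -scalemxAr !mxtraceZ curve_dir_energy// wD.
rewrite (_ : \sum_a _ = curve_speed U m w t *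
   (G * (1 - t * \sum_a U m a * w a 0) * q)); last first.
  rewrite -vw -curve_dir_row mulr_sumr; apply: eq_bigr => a _.
  by rewrite [in LHS]mxE mulrCA.
by rewrite [X in expR (X / _)]mulrA -expr2.
Qed.

End row_bound.

(** * Norms, condition number and incoherence *)

Section norms.
Context (R : realType).

Lemma norm2_ge0 n (x : 'cV[R]_n) : 0 <= norm2 x.
Proof. exact: sqrtr_ge0. Qed.

Lemma norm2_mulmx_orthonormal m n (W : 'M[R]_(m, n)) (x : 'cV[R]_n) :
  orthonormal_cols W -> norm2 (W *m x) = norm2 x.
Proof.
move=> WW; have sqr_sum k (y : 'cV[R]_k) : \sum_i y i 0 ^+ 2 = (y^T *m y) 0 0.
  by rewrite mxE; apply: eq_bigr => i _; rewrite mxE expr2.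
by rewrite /norm2 !sqr_sum trmx_mul mulmxA -(mulmxA x^T) WW mulmx1.
Qed.

(** On the unit ball every coordinate is at most 1 in absolute value. *)
Lemma has_ubound_spectral m n (M : 'M[R]_(m, n)) :
  has_ubound [set norm2 (M *m x) | x in [set x | norm2 x <= 1]].
Proof.
exists (Num.sqrt (\sum_i (\sum_j `|M i j|) ^+ 2)) => _ [x /= x1 <-].
have xj j : `|x j 0| <= 1.
  rewrite -sqrtr_sqr (le_trans _ x1)// ler_wsqrtr// (bigD1 j)//= lerDl.
  by apply: sumr_ge0 => i _; exact: sqr_ge0.
rewrite ler_wsqrtr//; apply: ler_sum => i _; rewrite mxE.
rewrite -real_normK ?num_real// lerXn2r ?nnegrE ?sumr_ge0//.
apply: le_trans (ler_norm_sum _ _ _) _; apply: ler_sum => j _.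
by rewrite normrM ler_piMr.
Qed.

(** The [a]-th right singular vector is a unit vector stretched by [lam 0 a]. *)
Lemma singular_value_le_spectral m n s (M : 'M[R]_(m, n)) W lam V (a : 'I_s) :
  is_rank_svd M W lam V -> lam 0 a <= spectral_norm M.
Proof.
case=> WW VV lam_gt0 _ ->; set N := _ *m _.
have nd (c : R) : 0 <= c -> norm2 (c *: delta_mx a 0 : 'cV[R]_s) = c.
  move=> c0; rewrite /norm2 (bigD1 a)//= big1 ?addr0.
    by rewrite !mxE !eqxx mulr1 sqrtr_sqr ger0_norm.
  by move=> i ia; rewrite !mxE (negbTE ia) mulr0 expr0n.
apply: ub_le_sup; first exact: has_ubound_spectral.
exists (V *m delta_mx a 0) => /=.
  by rewrite norm2_mulmx_orthonormal// -[delta_mx _ _]scale1r nd.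
rewrite /N -!mulmxA (mulmxA V^T) VV mul1mx norm2_mulmx_orthonormal//.
rewrite -[RHS]nd ?ltW//; congr norm2; apply/colP => i.
by rewrite mul_diag_mx !mxE; case: eqP => [->|]; rewrite ?mulr0.
Qed.

Lemma kappa_ge1 (p r : 'I_3 -> nat) (T : tensor R p)
    (U : forall j, 'M[R]_(p j, r j)) (lam : forall j : 'I_3, 'rV[R]_(r j))
    (V : forall j, 'M[R]_(p (ordS j) * p (ordS (ordS j)), r j)) :
  (forall j, 0 < r j)%N ->
  (forall j, is_rank_svd (unfold j T) (U j) (lam j) (V j)) ->
  1 <= kappa T lam.
Proof.
move=> r_gt0 svd; pose j : 'I_3 := ord0.
apply: le_trans (le_bigmax _ _ j).
have last_lt : ((r j).-1 < r j)%N by rewrite ltn_predL.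
rewrite (nth_map (Ordinal last_lt)) ?size_enum_ord//.
have [_ _ lam_gt0 _ _] := svd j.
by rewrite ler_pdivlMr ?lam_gt0// mul1r (singular_value_le_spectral _ (svd j)).
Qed.

Lemma sqr_row_le_norm2inf m n (W : 'M[R]_(m, n)) (i : 'I_m) :
  \sum_a W i a ^+ 2 <= norm2inf W ^+ 2.
Proof.
have rowE : norm2 (row i W)^T ^+ 2 = \sum_a W i a ^+ 2.
  rewrite sqr_sqrtr; first by apply: eq_bigr => a _; rewrite !mxE.
  by apply: sumr_ge0 => a _; exact: sqr_ge0.
have le_row : norm2 (row i W)^T <= norm2inf W by exact: (le_bigmax _ (fun i => norm2 (row i W)^T)).
by rewrite -rowE lerXn2r// nnegrE ?norm2_ge0// (le_trans (norm2_ge0 _) le_row).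
Qed.

Lemma norm2inf_ge0 m n (W : 'M[R]_(m, n)) : 0 <= norm2inf W.
Proof. exact: bigmax_ge_id. Qed.

Lemma orthonormal_dim_gt0 m n (W : 'M[R]_(m, n)) :
  orthonormal_cols W -> (0 < n)%N -> (0 < m)%N.
Proof.
case: m W => // W WW n_gt0; set a := Ordinal n_gt0.
have := congr1 (fun M : 'M[R]_n => M a a) WW.
by rewrite !mxE big_ord0 eqxx => /esym/eqP; rewrite oner_eq0.
Qed.

End norms.

Section incoherence.
Context (R : realType).

(** As [kap] is at least 1, the factor [kap ^+ 2] can only weaken the bound of
    [norm2inf] by [mu0 U] and the aspect ratio. *)
Lemma norm2inf_le_incoherence (p r : 'I_3 -> nat) (U : forall j, 'M[R]_(p j, r j))
    (k : 'I_3) (kap P Q C1 C2 : R) :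
  (0 < p k)%N -> (0 < r k)%N -> 1 <= kap -> 0 < P -> 0 < C1 -> 0 < C2 ->
  (r k)%:R <= C1 * Q -> P <= C2 * (p k)%:R ->
  norm2inf (U k) <= Num.sqrt (C1 * C2) * (kap ^+ 2 * mu0 U * Num.sqrt (Q / P)).
Proof.
move=> p_gt0 r_gt0 kap1 P_gt0 C1_gt0 C2_gt0 rQ Pp.
have p0 : 0 < (p k)%:R :> R by rewrite ltr0n.
have r0 : 0 < (r k)%:R :> R by rewrite ltr0n.
have mu_ge : Num.sqrt ((p k)%:R / (r k)%:R) * norm2inf (U k) <= mu0 U.
  exact: (le_bigmax _ (fun j => Num.sqrt ((p j)%:R / (r j)%:R) * norm2inf (U j))).
have mu_ge0 : 0 <= mu0 U by exact: bigmax_ge_id.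
have ratio : (r k)%:R / (p k)%:R <= C1 * C2 * (Q / P).
  have -> : C1 * C2 * (Q / P) = C1 * Q * (C2 / P) by ring.
  apply: ler_pM => //.
  by rewrite ler_pdivlMr// ler_pdivrMl// mulrC.
rewrite -(ler_pM2l (_ : 0 < Num.sqrt ((p k)%:R / (r k)%:R))); last first.
  by rewrite sqrtr_gt0 divr_gt0.
apply: le_trans mu_ge _.
have C12 : 0 <= C1 * C2 by rewrite mulr_ge0 ?ltW.
rewrite [leRHS](_ : _ = kap ^+ 2 * mu0 U * (Num.sqrt ((p k)%:R / (r k)%:R)
    * (Num.sqrt (C1 * C2) * Num.sqrt (Q / P)))); last ring.
rewrite -sqrtrM// -sqrtrM ?(divr_ge0 (ltW p0) (ltW r0))//.
rewrite -[leLHS]mulr1 ler_pM ?ler01//.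
  by rewrite ler_peMl// exprn_ege1.
rewrite -[leLHS]sqrtr1 ler_wsqrtr//.
rewrite -[leLHS](_ : (p k)%:R / (r k)%:R * ((r k)%:R / (p k)%:R) = 1).
  by rewrite ler_wpM2l// divr_ge0 ?ltW.
by field; rewrite !gt_eqF.
Qed.

End incoherence.

(** * The asymptotic bound *)

Lemma invmx_sqr_diag (R : realType) (s : nat) (lam : 'rV[R]_s) :
  (forall a, 0 < lam 0 a) ->
  invmx (diag_mx lam *m diag_mx lam) = diag_mx (\row_a (lam 0 a ^+ 2)^-1).
Proof.
move=> lam_gt0; set D := _ *m _; set Q := diag_mx _.
have DQ : D *m Q = 1%:M.
  apply/matrixP => i j; rewrite /D /Q mulmx_diag mul_mx_diag !mxE.
  by case: eqP => [->|_]; rewrite ?mulr0n ?mul0r// mulr1n -expr2 divff// expf_neq0 ?gt_eqF.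
have [D_unit _] := mulmx1_unit DQ.
by rewrite -[RHS](mulKmx D_unit) DQ mulmx1.
Qed.

Theorem theorem4 (R : realType)
  (p r : nat -> R) (pd rd : nat -> 'I_3 -> nat)
  (p_infty : p @ \oo --> +oo)
  (pd_asymp : forall k : 'I_3, asymp (fun n => (pd n k)%:R) p)
  (rd_asymp : forall k : 'I_3, asymp (fun n => (rd n k)%:R) r)
  (rd_gt0 : forall n k, (0 < rd n k)%N)
  (theta : forall n, tucker_param R (pd n) (rd n))
  (Lam : forall n (k : 'I_3), 'rV[R]_(rd n k))
  (V : forall n (k : 'I_3),
     'M[R]_(pd n (ordS k) * pd n (ordS (ordS k)), rd n k))
  (theta_svd : forall n k,
     is_rank_svd (unfold k (signal (theta n))) (fac (theta n) k) (Lam n k) (V n k))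
  (smin smax : nat -> R) (sigma : forall n, tensor R (pd n))
  (smin_gt0 : forall n, 0 < smin n)
  (sigma_bounds : forall n i, smin n <= sigma n i <= smax n)
  (smax_smin : lesssim smax smin)
  (d : nat -> measure_display) (Omega : forall n, measurableType (d n))
  (P : forall n, probability (Omega n) R)
  (Z : forall n, midx (pd n) -> {RV (P n) >-> R})
  (Z_gauss : forall n, gaussian_noise (Z n) (sigma n))
  (incoherence :
     (fun n => kappa (signal (theta n)) (Lam n) ^+ 2 * mu0 (fac (theta n))
               * Num.sqrt (r n / p n)) @ \oo --> (0 : R)) :
  exists delta : nat -> R, delta @ \oo --> (0 : R) /\
    forall n (k : 'I_3) (m : 'I_(pd n k))
           (Theta : set (tucker_param R (pd n) (rd n)))
           (X : tensor R (pd n) -> 'cV[R]_(rd n k)),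
      parameter_space Theta (theta n) k ->
      measurable_estimator X ->
      unbiased (Z n) Theta m X ->
      (forall a, (fun w => X (observe (signal (theta n)) (Z n) w) a 0)
                   \in Lfun (P n) 2%:E) ->
      psd_ge
        (covariance_mx (P n) (fun w => X (observe (signal (theta n)) (Z n) w)))
        ((smin n ^+ 2 * (1 - delta n)) *:
           invmx (diag_mx (Lam n k) *m diag_mx (Lam n k))).
Proof.
have pd_gt0 n k : (0 < pd n k)%N.
  by have [UU _ _ _ _] := theta_svd n k; exact: orthonormal_dim_gt0 UU (rd_gt0 n k).
pose x n := kappa (signal (theta n)) (Lam n) ^+ 2 * mu0 (fac (theta n)) *
  Num.sqrt (r n / p n).
have norm2inf_bound (k : 'I_3) : exists K : R, forall n,
    norm2inf (fac (theta n) k) <= K * x n.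
  have [_ [C2 C2_gt0 pC2]] := pd_asymp k.
  have [[C1 C1_gt0 rC1] _] := rd_asymp k.
  have [[C3 C3_gt0 pC3] _] := pd_asymp k.
  exists (Num.sqrt (C1 * C2)) => n.
  apply: norm2inf_le_incoherence => //; first exact: (kappa_ge1 (rd_gt0 n) (theta_svd n)).
  have : 0 < C3 * p n by apply: lt_le_trans (pC3 n); rewrite ltr0n.
  by rewrite pmulr_rgt0.
(* A sum over the modes serves as a bound uniform in the mode and the row. *)
exists (fun n => \sum_(k < 3) norm2inf (fac (theta n) k) ^+ 2); split.
  suff cvg0 (k : 'I_3) : norm2inf (fac (theta n) k) ^+ 2 @[n --> \oo] --> (0 : R).
    rewrite (_ : (fun n => \sum_(j < 3) _) = fun n =>
      norm2inf (fac (theta n) ord0) ^+ 2 +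
      norm2inf (fac (theta n) (lift ord0 ord0)) ^+ 2 +
      norm2inf (fac (theta n) (lift ord0 (lift ord0 ord0))) ^+ 2); last first.
      by apply/funext => n; rewrite !big_ord_recl big_ord0 addr0 addrA.
    rewrite -[X in _ --> X]addr0; apply: cvgD => //.
    by rewrite -[X in _ --> X]addr0; apply: cvgD.
  have [K leK] := norm2inf_bound k.
  have Kx0 : (K * x n) ^+ 2 @[n --> \oo] --> (0 : R).
    have Kx : K * x n @[n --> \oo] --> (K * 0 : R) by apply: cvgM => //; exact: cvg_cst.
    rewrite mulr0 in Kx.
    rewrite -[X in _ --> X](mulr0 0); under eq_fun do rewrite expr2.
    exact: cvgM.
  apply: (squeeze_cvgr _ (cvg_cst _) Kx0).
  apply: nearW => n; rewrite sqr_ge0 lerXn2r// nnegrE ?norm2inf_ge0//.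
  by rewrite (le_trans (norm2inf_ge0 _) (leK n)).
move=> n k m Theta X Theta_th mX X_unbiased X2.
have svd := theta_svd n k; have [_ _ lam_gt0 _ _] := svd.
rewrite invmx_sqr_diag//; split.
  apply/matrixP => a b; rewrite !mxE; congr (fine _ - _ * _).
    exact: covarianceC.
  by rewrite eq_sym; case: eqP => // ->.
have entryB (M N : 'M[R]_1) : (M - N) 0 0 = M 0 0 - N 0 0 by rewrite !mxE.
move=> v; rewrite mulmxBr mulmxBl entryB covariance_mx_quad//.
set q := \sum_a (v a 0 / Lam n k 0 a) ^+ 2.
have -> : (v^T *m (smin n ^+ 2 * (1 - \sum_(k < 3) norm2inf (fac (theta n) k) ^+ 2)
    *: diag_mx (\row_a (Lam n k 0 a ^+ 2)^-1)) *m v) 0 0 =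
    smin n ^+ 2 * (1 - \sum_(k < 3) norm2inf (fac (theta n) k) ^+ 2) * q.
  rewrite -scalemxAr -scalemxAl mxE; congr (_ * _).
  rewrite mxE; apply: eq_bigr => a _; rewrite mul_mx_diag !mxE exprMn exprVn.
  by rewrite expr2 mulrAC.
rewrite subr_ge0.
have := variance_row_ge svd (smin_gt0 n) (fun i => proj1 (andP (sigma_bounds n i)))
  (Z_gauss n) Theta_th mX X_unbiased X2 v.
apply: le_trans; rewrite -mulrA ler_wpM2l ?sqr_ge0// ler_wpM2r//.
  by apply: sumr_ge0 => a _; exact: sqr_ge0.
rewrite lerD2l lerN2; apply: le_trans (sqr_row_le_norm2inf _ m) _.
by rewrite (bigD1 k)//= lerDl; apply: sumr_ge0 => j _; exact: sqr_ge0.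
Qed.
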